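(* Let $D$ be a semicomplete multipartite digraph and let $F$ be a 1-path-cycle factor in $D$. Let $P$ denote the path in $F$ and assume that the initial and terminal vertices of $P$ belong to different partite sets of $D$. Then $D$ contains a Hamilton (directed) path whose initial and terminal vertices belong to different partite sets.
   Context: A semicomplete $p$-partite (multipartite) digraph ($p\ge 2$) is obtained from a complete $p$-partite graph by replacing each edge $\{x,y\}$ by the arc $xy$, the arc $yx$, or both arcs; its partite sets are the maximal independent sets. A 1-path-cycle factor of a digraph $H$ is a spanning subdigraph of $H$ consisting of one non-empty directed path and a possibly empty collection of directed cycles, all vertex-disjoint. *)

(* Defs.v *)
(* Finite digraphs: the vertex set is a [finType] and [D x y] means
   that [xy] is an arc. *)
From mathcomp Require Import all_boot.

Set Implicit Arguments.
Unset Strict Implicit.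
Unset Printing Implicit Defensive.

Section Digraphs.

Variables (T : finType) (D : rel T).

(* [X] is the family of partite sets of a complete [p]-partite graph on [T]:
   [x] and [y] are joined by an edge iff they lie in different blocks, and
   [partition] makes all the blocks nonempty.  Taking [x = y] shows that [D] has
   no loops. *)
Definition semicomplete_partite (p : nat) (X : {set {set T}}) : Prop :=
  [/\ 2 <= p, partition X [set: T], #|X| = p
    & forall x y : T, D x y || D y x = (pblock X x != pblock X y)].

Definition independent (A : {set T}) : bool :=
  [forall x in A, forall y in A, ~~ D x y].

Definition different_partite_sets (X : {set {set T}}) (x y : T) : Prop :=
  exists A B : {set T}, [/\ A \in X, B \in X, x \in A, y \in B & A != B].

(* The directed path with vertex sequence [x :: s], from [x] to [last x s]. *)
Definition dipath (x : T) (s : seq T) : bool :=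
  path D x s && uniq (x :: s).

(* The closing arc from the last vertex of [c] to its head is part of [cycle];
   cycles of length 2 are allowed. *)
Definition dicycle (c : seq T) : bool :=
  [&& 2 <= size c, cycle D c & uniq c].

(* The factor consisting of the path [x :: s] and the cycles listed in [C]. *)
Definition one_path_cycle_factor (x : T) (s : seq T) (C : seq (seq T)) : Prop :=
  [/\ dipath x s, all dicycle C, uniq ((x :: s) ++ flatten C)
    & forall v : T, v \in (x :: s) ++ flatten C].

Definition hamilton_path (x : T) (s : seq T) : Prop :=
  dipath x s /\ forall v : T, v \in x :: s.

Lemma different_partite_setsE p X x y :
  semicomplete_partite p X ->
  different_partite_sets X x y <-> pblock X x != pblock X y.
Proof.
case=> _ /and3P[/eqP covX trivX _] _ _; split.
  case=> A [B [AX BX xA yB]].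
  by rewrite (def_pblock trivX AX xA) (def_pblock trivX BX yB).
move=> nxy; exists (pblock X x), (pblock X y).
by split; rewrite ?pblock_mem ?mem_pblock ?covX ?inE.
Qed.

Lemma partite_sets_maximal_independent p X A :
  semicomplete_partite p X -> (A \in X) = maxset independent A.
Proof.
case=> p2 /and3P[/eqP covX trivX X0] cardX adj.
have inX z : z \in cover X by rewrite covX inE.
have indP (B : {set T}) : reflect {in B &, forall x y, pblock X x = pblock X y}
                      (independent B).
  apply: (iffP forall_inP) => [ind x y xB yB | same x xB].
    apply/eqP; apply: contraT; rewrite -adj => /orP[] a.
      by have /forall_inP/(_ y yB) := ind x xB; rewrite a.
    by have /forall_inP/(_ x xB) := ind y yB; rewrite a.
  apply/forall_inP => y yB; have := adj x y.
  by rewrite (same x y xB yB) eqxx => /negbT; rewrite negb_or => /andP[].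
have indX (B : {set T}) : B \in X -> independent B.
  move=> BX; apply/indP => x y xB yB.
  by rewrite (def_pblock trivX BX xB) (def_pblock trivX BX yB).
have sub (B : {set T}) z : z \in B -> independent B -> B \subset pblock X z.
  move=> zB /indP same; apply/subsetP => w wB.
  by rewrite (same z w zB wB) mem_pblock.
apply/idP/maxsetP => [AX | [indA maxA]].
  split=> [|B indB AB]; first exact: indX.
  have /set0Pn[z zA] : A != set0 by apply: contraNneq X0 => <-.
  apply/eqP; rewrite eqEsubset AB andbT -(def_pblock trivX AX zA).
  exact: sub (subsetP AB z zA) indB.
have [A0 | [z zA]] := set_0Vmem A; last first.
  by rewrite -(maxA (pblock X z)) ?pblock_mem ?sub // indX ?pblock_mem.
have /card_gt0P[B BX] : 0 < #|X| by rewrite cardX (leq_trans _ p2).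
by rewrite -(maxA B) ?indX // A0 sub0set.
Qed.

End Digraphs.

(* Main.v *)
(** Merge the cycles into the path one at a time, keeping the end vertices in
    different partite sets.  Let [P] run from [x] to [y] and let [C] be a
    cycle.  A piece [a ... b] of [C] can be inserted into an arc [pq] of [P]
    when [pa] and [bq] are arcs, and if a section of [C] splits into pieces each
    of which can be inserted into some arc of [P], then the whole section can be
    absorbed into [P] without changing its end vertices.

    Suppose no merge exists.  Take [c] in [C], with successor [d], and let [q] be
    the first vertex of [P] dominated by [c].  Unless [q = x], the predecessor
    [p] of [q] either dominates [c], and then [c] can be inserted, or lies in
    the partite set of [c]; in that case [d] dominates [p] (otherwise all of
    [C] fits into [pq]), and [cd] can be inserted just before [p], unless
    [p = x].  If no vertex of [C] dominates [x] and none is dominated by [y],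
    every [c] is thus covered by a piece [c] or [cd], and a vertex [c] with [q]
    as early as possible can be inserted alone, so that all of [C] splits.
    If some [c] dominates [x], then its successor lies in the partite set of
    [y]; one inserts pieces starting there until the rest of [C], which ends in
    [c], starts outside the partite set of [y], and puts that rest in front of
    [x].  This, its mirror image at [y], and one explicit path settle the
    remaining cases. *)
Require Import Defs.
From mathcomp Require Import all_boot.

Set Implicit Arguments.
Unset Strict Implicit.
Unset Printing Implicit Defensive.

(** * Inserting pieces of a sequence into arcs of a path *)

Section Insertion.

Variables (T : eqType) (D : rel T).

Definition arcs (x : T) (s : seq T) : seq (T * T) := pairmap pair x s.

Lemma arcsP x s p q :
  (p, q) \in arcs x s -> exists l1 l2, s = l1 ++ q :: l2 /\ last x l1 = p.
Proof.
elim: s x => [//|z s IH] x; rewrite inE => /orP[/eqP[-> ->]|/IH[l1 [l2 [-> <-]]]].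
  by exists [::], s.
by exists (z :: l1), l2.
Qed.

Lemma arcs_cat x l1 q l2 :
  arcs x (l1 ++ q :: l2) = arcs x l1 ++ (last x l1, q) :: arcs q l2.
Proof. by rewrite /arcs pairmap_cat. Qed.

Definition insertable (E : seq (T * T)) (a b : T) : bool :=
  has (fun e => D e.1 a && D b e.2) E.

Lemma insertableI E p q a b :
  (p, q) \in E -> D p a -> D b q -> insertable E a b.
Proof. by move=> pqE pa bq; apply/hasP; exists (p, q); rewrite //= pa. Qed.

(** Different pieces may claim the same arc of [E]; [multi_insert] resolves such conflicts. *)
Inductive pieces_insertable (E : seq (T * T)) : seq T -> Prop :=
| PiecesNil : pieces_insertable E [::]
| PiecesCons a l s : insertable E a (last a l) -> pieces_insertable E s ->
    pieces_insertable E (a :: l ++ s).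

(* The prefix [b] is chosen so that no later piece ends in a vertex
   dominating [q]; the later pieces then do not use any arc into [q]. *)
Lemma pieces_insertable_avoid E q s z :
  pieces_insertable E s -> D z q ->
  exists b s', [/\ s = b ++ s', D (last z b) q
                 & pieces_insertable [seq e <- E | e.2 != q] s'].
Proof.
move=> H; elim: H z => [|a l s0 insa _ IH] z zq.
  by exists [::], [::]; split=> //; constructor.
case aq: (D (last a l) q).
  have [b [s' [-> bq ps']]] := IH _ aq.
  by exists (a :: l ++ b), s'; rewrite /= -catA last_cat; split.
have [[|b0 b] [s' [-> bq ps']]] := IH _ zq.
  exists [::], (a :: l ++ s'); split=> //; constructor=> //.
  case/hasP: insa => -[p' q'] /= eE /andP[pa aq']; apply: (@insertableI _ p' q') => //.
  by rewrite mem_filter eE andbT /=; apply: contraFneq aq => <-.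
by exists (a :: l ++ b0 :: b), s'; rewrite /= -!catA last_cat; split.
Qed.

(** Induction on the length of [s]. The first piece, prolonged by [b], goes into the arc [pq]; the
    remaining pieces use no arc into [q], so their arcs survive in the longer path. *)
Lemma multi_insert (E : seq (T * T)) x t s :
  path D x t -> {subset E <= arcs x t} -> pieces_insertable E s ->
  sorted D s ->
  exists t', [/\ path D x t', last x t' = last x t
               & perm_eq (x :: t') (x :: t ++ s)].
Proof.
have [n] := ubnP (size s).
elim: n => // n IH in E t s * => ltn pt sE ps ss.
case: ps => [|a l s0 /hasP[[p q] /= pqE /andP[pa aq]] ps0] in ltn ss *.
  by exists t; rewrite cats0; split.
have [b [s' [es0 bq ps']]] := pieces_insertable_avoid ps0 aq.
have [l1 [l2 [et ep]]] := arcsP (sE _ pqE).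
subst s0 t p; set t1 := l1 ++ (a :: l ++ b) ++ q :: l2.
move: ss pt; rewrite /= !cat_path /= => /and3P[al lb bs'] /and3P[xl1 l1q ql2].
have pt1 : path D x t1.
  by rewrite /t1 !cat_path /= cat_path last_cat xl1 pa al lb bq ql2.
have [|||t' [pt' lt' pet']] := IH _ t1 s' _ pt1 _ ps'.
- by move: ltn; rewrite ltnS; apply: leq_ltn_trans; rewrite !size_cat addnA leq_addl.
- move=> [p' q']; rewrite mem_filter /= => /andP[nq /sE].
  rewrite /t1 /= !arcs_cat !mem_cat !inE xpair_eqE (negPf nq) andbF /=.
  by rewrite mem_cat inE; case/orP=> ->; rewrite ?orbT.
- by apply: path_sorted bs'.
exists t'; split=> //.
  by rewrite lt' /t1 /= !last_cat /= last_cat.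
apply: perm_trans pet' _; rewrite perm_cons.
have -> : a :: l ++ b ++ s' = (a :: l ++ b) ++ s' by rewrite /= catA.
by rewrite /t1 -!(catA l1) perm_cat2l -catA perm_catCA.
Qed.

(** A greedy split into single vertices and consecutive pairs never gets stuck: a last vertex left
    over is insertable alone. *)
Lemma pieces_insertable_greedy (E : seq (T * T)) c l :
  path (fun u v => insertable E u u || insertable E u v) c l ->
  insertable E (last c l) (last c l) -> pieces_insertable E (c :: l).
Proof.
have [n] := ubnP (size l); elim: n => // n IH in c l *.
case: l => [_ _ i|v l] /=; first exact: (@PiecesCons _ c [::] [::]) i (PiecesNil _).
rewrite ltnS => ltn /andP[/orP[ic|icv] pl il].
  by apply: (@PiecesCons _ c [::] (v :: l)) => //; exact: IH.
case: l => [|w l] in ltn pl il *.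
  apply: (@PiecesCons _ c [:: v] [::]) => //; exact: PiecesNil.
apply: (@PiecesCons _ c [:: v] (w :: l)) => //.
by apply: IH => //; [exact: ltnW | case/andP: pl].
Qed.

End Insertion.

(** * Opening a cycle at a vertex *)

Section CycleRotation.

Variables (T : eqType) (D : rel T) (C : seq T).
Hypotheses (cycC : cycle D C) (uniqC : uniq C).

Lemma cycle_rotate_to c : c \in C -> ~~ D c c ->
  exists l, [/\ perm_eq (next C c :: l) C, path D (next C c) l,
                fpath (next C) (next C c) l & last (next C c) l = c].
Proof.
move=> cC nDc; have [i r er] := rot_to cC.
have cyr : cycle D (c :: r) by rewrite -er rot_cycle.
have fcr : fcycle (next C) (c :: r) by rewrite -er rot_cycle cycle_next.
have per : perm_eq (c :: r) C by rewrite -er perm_rot.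
case: r => [|d l] in er cyr fcr per *; first by rewrite /= (negPf nDc) in cyr.
move: fcr cyr; rewrite /= => /andP[/eqP -> f] /andP[_ g].
exists (rcons l c); split=> //; last by rewrite last_rcons.
by apply: perm_trans per; rewrite -rcons_cons perm_rcons.
Qed.

End CycleRotation.

(** * Merges of a path and a cycle under a colouring *)

Section Merge.

Variables (T : finType) (K : eqType) (col : T -> K).

(* [col] gives the partite set of a vertex. *)
Definition semicomplete_col (D : rel T) : Prop :=
  forall u v, D u v || D v u = (col u != col v).

(** Tuples of fixed length make this boolean, so that arguments by contraposition stay
    constructive. *)
Definition mergeable (D : rel T) (x : T) (s C : seq T) : bool :=
  [exists w : (size (x :: s ++ C)).-tuple T,
    [&& sorted D w, perm_eq w (x :: s ++ C) & col (head x w) != col (last x w)]].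

Lemma mergeableP D x s C :
  reflect (exists y t, [/\ path D y t, perm_eq (y :: t) (x :: s ++ C)
                         & col y != col (last y t)])
          (mergeable D x s C).
Proof.
apply: (iffP existsP) => [[w /and3P[]]|[y [t [pt pe ne]]]].
  case: (tval w) => [_ /perm_size //|y t] pt pe ne.
  by exists y, t.
have szt : size (y :: t) == size (x :: s ++ C) by rewrite (perm_size pe).
by exists (Tuple szt); apply/and3P.
Qed.

Lemma semicomplete_col_converse D :
  semicomplete_col D -> semicomplete_col (fun u v => D v u).
Proof. by move=> adj u v; rewrite adj eq_sym. Qed.

Lemma mergeable_converse D x s C :
  mergeable (fun u v => D v u) (last x s) (rev (belast x s)) (rev C) ->
  mergeable D x s C.
Proof.
case/mergeableP => y [t [pt pe ne]]; apply/mergeableP.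
exists (last y t), (rev (belast y t)).
have rl z r : last z r :: rev (belast z r) = rev (z :: r) by rewrite [in RHS]lastI rev_rcons.
have lr z r : last (last z r) (rev (belast z r)) = z.
  by rewrite -(last_cons z) rl rev_cons last_rcons.
split; [by rewrite rev_path| |by rewrite lr eq_sym].
rewrite rl perm_rev (perm_trans pe) // -cat_cons rl.
by rewrite -[_ :: s ++ C]cat_cons perm_cat // perm_rev.
Qed.

(** * Consequences of the absence of a merge *)

Section NoMerge.

Variables (D : rel T) (x : T) (s C : seq T).
Hypotheses (adj : semicomplete_col D) (pathP : path D x s).
Hypotheses (cycC : cycle D C) (uniqC : uniq C).
Hypotheses (nxy : col x != col (last x s)) (noM : ~~ mergeable D x s C).

Local Notation y := (last x s).
Local Notation E := (arcs x s).
Local Notation nxt := (next C).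

Lemma arc_col u v : D u v -> col u != col v.
Proof. by move=> uv; rewrite -adj uv. Qed.

Lemma loopless u : ~~ D u u.
Proof. by apply/negP => /arc_col; rewrite eqxx. Qed.

Lemma arc_of_col u v : col u != col v -> ~~ D v u -> D u v.
Proof. by rewrite -adj => /orP[//|->]. Qed.

Lemma next_arc c : c \in C -> D c (nxt c).
Proof. exact: next_cycle. Qed.

Lemma mem_next_cycle c : c \in C -> nxt c \in C.
Proof. by rewrite mem_next. Qed.

Lemma cycle_not_insertable c : c \in C -> ~~ insertable D E (nxt c) c.
Proof.
move=> cC; apply: contra noM => ins.
have [l [pe pl _ ll]] := cycle_rotate_to cycC uniqC cC (loopless c).
have [||t' [pt' lt' pe']] := @multi_insert _ D E x s (nxt c :: l) pathP _ _ pl.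
- by [].
- by rewrite -[nxt c :: l]cats0 cat_cons; constructor; rewrite ?ll //; constructor.
apply/mergeableP; exists x, t'; split; rewrite ?lt' //.
by apply: perm_trans pe' _; rewrite perm_cons perm_cat2l.
Qed.

Lemma no_parallel_arcs c p q :
  c \in C -> (p, q) \in E -> D p (nxt c) -> ~~ D c q.
Proof.
move=> cC pq pc; apply: contra (cycle_not_insertable cC).
exact: insertableI pq pc.
Qed.

Lemma col_next_of_arc_to_start c : c \in C -> D c x -> col (nxt c) = col y.
Proof.
move=> cC cx; apply/eqP; apply: contraR noM => ne.
have [l [pe pl _ ll]] := cycle_rotate_to cycC uniqC cC (loopless c).
apply/mergeableP; exists (nxt c), (l ++ x :: s).
split; rewrite ?last_cat ?cat_path ?ll /= ?pl ?cx //.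
by rewrite -cat_cons -(cat_cons x) perm_catC perm_cat2l.
Qed.

Lemma col_of_arc_from_end c : c \in C -> D y (nxt c) -> col c = col x.
Proof.
move=> cC yc; apply/eqP; apply: contraR noM => ne.
have [l [pe pl _ ll]] := cycle_rotate_to cycC uniqC cC (loopless c).
apply/mergeableP; exists x, (s ++ nxt c :: l).
split; rewrite ?last_cat ?cat_path /= ?ll ?pathP ?yc //; last by rewrite eq_sym.
by rewrite perm_cons perm_cat2l.
Qed.

Lemma first_arc : exists q t, [/\ s = q :: t, (x, q) \in E & D x q].
Proof.
move: pathP nxy; case: s => [|q t] /=; first by rewrite eqxx.
by case/andP=> xq _ _; exists q, t; rewrite inE eqxx.
Qed.

Lemma last_arc : exists p, [/\ (p, y) \in E, p \in x :: s & D p y].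
Proof.
move: pathP nxy; case/lastP: s => [|t q]; first by rewrite eqxx.
rewrite last_rcons rcons_path => /andP[_ pq] _; exists (last x t).
rewrite -cats1 arcs_cat mem_cat inE eqxx orbT pq; split=> //.
by rewrite -cat_cons mem_cat mem_last.
Qed.

Lemma first_out_step c : c \in C -> has (D c) (x :: s) ->
  [\/ D c x, insertable D E c c
    | [/\ has (D (nxt c)) (x :: s),
          find (D (nxt c)) (x :: s) < find (D c) (x :: s)
        & insertable D E c (nxt c) \/ col c = col x /\ D (nxt c) x]].
Proof.
move=> cC; case: (findP (D c) (x :: s)) => // i ltis ci before _.
case: i => [|i] in ltis ci before *; first by constructor 1; exact: (ci x).
set p := nth x (x :: s) i; set q := nth x (x :: s) i.+1.
have arcE j : j < size s -> (nth x (x :: s) j, nth x (x :: s) j.+1) \in E.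
  move=> ltjs; rewrite -(nth_pairmap x (x, x)) // mem_nth //.
  by rewrite size_pairmap.
have pqE : (p, q) \in E := arcE i ltis.
have cq : D c q := ci x.
have ncp : ~~ D c p by rewrite (before x).
case pc: (D p c); first by constructor 2; exact: insertableI pqE pc cq.
have cp : col c = col p by apply/eqP; rewrite -[_ == _]negbK -adj (negPf ncp) pc.
have npd : ~~ D p (nxt c).
  by apply/negP => pd; move: (no_parallel_arcs cC pqE pd); rewrite cq.
have dp : D (nxt c) p.
  by apply: arc_of_col npd; rewrite -cp eq_sym arc_col // next_arc.
have pP : p \in x :: s by rewrite mem_nth // ltnW.
constructor 3; split; first by apply/hasP; exists p.
  rewrite ltnS leqNgt; apply/negP => lt.
  by move: (before_find x lt); rewrite -/p dp.
case: i => [|i] in ltis ci before p q arcE pqE cq ncp pc cp npd dp pP *.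
  by right.
(* The predecessor of [p] comes before [q], so [c] does not dominate it; by colour it dominates [c],
   and [c], [nxt c] fit just before [p]. *)
left; have ppE := arcE i (ltnW ltis).
apply: (insertableI ppE) dp; apply: arc_of_col; last by rewrite (before x).
rewrite cp; apply: arc_col; have [l1 [l2 [es <-]]] := arcsP ppE.
by move: pathP; rewrite {1}es cat_path /= => /and3P[].
Qed.

(** The predecessor of [y] on the path must dominate [nxt c]; were [c] to dominate [y], all of the
    cycle would fit into the last arc. *)
Lemma no_out_arcs c : c \in C -> col (nxt c) = col y ->
  ~~ has (D (nxt c)) (x :: s) -> D y c.
Proof.
move=> cC cy /hasPn no; have [p [pyE pP py]] := last_arc.
have pd : D p (nxt c) by apply: arc_of_col (no p pP); rewrite cy arc_col.
apply: arc_of_col (no_parallel_arcs cC pyE pd).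
by rewrite -cy eq_sym arc_col // next_arc.
Qed.

(** The bound [n] serves an induction whose steps consume one or two vertices. The part [a] will be
    absorbed into the path, and [b] put in front of [x]. *)
Lemma insert_until_start_ok n u l c :
  size l < n -> u \in C -> fpath nxt u l -> last u l = c ->
  D c x -> col u = col y -> col c != col y -> has (D u) (x :: s) ->
  exists a b, [/\ u :: l = a ++ b, pieces_insertable D E a
                & b = [::] \/ exists v b', b = v :: b' /\ col v != col y].
Proof.
elim: n u l => // n IH u [|v l] ltn uC /=.
  by move=> _ -> _ ->; rewrite eqxx.
case/andP=> /eqP ev fl ll cx uy ncy hu; subst v.
have uv := next_arc uC; have vC := mem_next_cycle uC.
case: (first_out_step uC hu) => [ux | iu | [hv _ [iuv|[ux _]]]].
- by move: (arc_col uv); rewrite (col_next_of_arc_to_start uC ux) uy eqxx.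
- exists [:: u], (nxt u :: l); split=> //.
    by apply: (@PiecesCons _ _ _ u [::] [::]) => //; constructor.
  by right; exists (nxt u), l; rewrite -uy eq_sym arc_col.
- have pc r : pieces_insertable D E r -> pieces_insertable D E [:: u, nxt u & r].
    by move=> pr; apply: (@PiecesCons _ _ _ u [:: nxt u] r).
  case: l => [|w l] in ltn fl ll *.
    exists [:: u; nxt u], [::]; split=> //; last by left.
    by apply: pc; constructor.
  move: fl; rewrite /= => /andP[/eqP ew fl]; subst w.
  case: (eqVneq (col (nxt (nxt u))) (col y)) => [wy|nwy]; last first.
    exists [:: u; nxt u], (nxt (nxt u) :: l); split=> //.
      by apply: pc; constructor.
    by right; exists (nxt (nxt u)), l.
  (* Otherwise [y] dominates [nxt u], which gives [u] the colour of [x] instead of that of [y]. *)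
  have hw : has (D (nxt (nxt u))) (x :: s).
    apply: contraT => /(no_out_arcs vC wy) /(col_of_arc_from_end uC).
    by rewrite uy => /eqP; rewrite eq_sym (negPf nxy).
  have [|a [b [eab pa hb]]] := IH _ _ _ (mem_next_cycle vC) fl ll cx wy ncy hw.
    exact: ltnW.
  exists [:: u, nxt u & a], b; split=> //; last exact: pc.
  by rewrite eab.
- by move: nxy; rewrite -ux uy eqxx.
Qed.

Lemma no_out_arcs_after_arc_to_start c :
  c \in C -> D c x -> ~~ has (D (nxt c)) (x :: s).
Proof.
move=> cC cx; apply: contra noM => hd.
have dy := col_next_of_arc_to_start cC cx.
have ncy : col c != col y by rewrite -dy arc_col // next_arc.
have [l [pe pl fl ll]] := cycle_rotate_to cycC uniqC cC (loopless c).
have [a [b [eab pa hb]]] :=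
  insert_until_start_ok (ltnSn _) (mem_next_cycle cC) fl ll cx dy ncy hd.
have sab : sorted D (a ++ b) by rewrite -eab.
have [|t' [pt' lt' pe']] := multi_insert pathP (fun _ => id) pa.
  by have [] := cat_sorted2 sab.
have pe2 : perm_eq (b ++ x :: t') (x :: s ++ C).
  rewrite -cat_cons perm_catC (perm_trans (y := (x :: s ++ a) ++ b)) //.
    by rewrite perm_cat2r.
  by rewrite -cat_cons -catA -eab perm_cat2l.
apply/mergeableP; case: hb => [b0|[v [b' [eb nvy]]]].
  by exists x, t'; rewrite lt'; split=> //; rewrite b0 in pe2.
exists v, (b' ++ x :: t'); rewrite eb in sab pe2 eab.
have lb : last v b' = c.
  by have := congr1 (last c) eab; rewrite last_cat /= ll.
have [_ pb] := cat_sorted2 sab.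
by split; rewrite ?last_cat ?cat_path /= ?lb ?lt' ?cx ?andbT //; exact/andP.
Qed.

(* The merge would be the path [x, c^+, ..., c^-, p_2, ..., y, c], where
   [P = x, p_2, ..., y], [b = c^-] and [c = next C b]. *)
Lemma no_bypass b p2 t : b \in C -> s = p2 :: t -> D b p2 ->
  D x (nxt (nxt b)) -> D y (nxt b) -> ~~ D (nxt b) x.
Proof.
set c := nxt b => bC es bp xd yc; apply: contra noM => cx.
have cC : c \in C := mem_next_cycle bC.
have [l [pe pl fl ll]] := cycle_rotate_to cycC uniqC cC (loopless c).
case/lastP: l => [|l z] in pe pl fl ll *.
  by move: (next_arc cC); rewrite /= in ll; rewrite ll (negPf (loopless c)).
rewrite last_rcons in ll; subst z; move: fl pl.
rewrite !rcons_path => /andP[_ /eqP eb] /andP[pl _].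
have lb : last (nxt c) l = b by apply: (can_inj (prev_next uniqC)).
have pbs : path D b s by move: pathP; rewrite es /= bp => /andP[].
apply/mergeableP; exists x, ((nxt c :: l) ++ rcons s c); split.
- by rewrite cat_path /= xd pl lb rcons_path pbs es /=; rewrite es in yc.
- rewrite perm_cons -cats1 perm_catCA perm_cat2l.
  by rewrite cats1.
- by rewrite last_cat last_rcons eq_sym arc_col.
Qed.

End NoMerge.
(** Arc reversal exchanges the ends of the path, and [next] with [prev]. *)
Lemma no_in_arcs_before_arc_from_end D x s C c :
  semicomplete_col D -> path D x s -> cycle D C -> uniq C ->
  col x != col (last x s) -> ~~ mergeable D x s C ->
  c \in C -> D (last x s) c -> ~~ has (fun u => D u (prev C c)) (x :: s).
Proof.
move=> adj pP cC uC ne noM cinC yc.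
have revP : last (last x s) (rev (belast x s)) = x.
  by case: s {pP ne noM yc} => //= z r; rewrite rev_cons last_rcons.
have := @no_out_arcs_after_arc_to_start (fun u v => D v u) (last x s)
  (rev (belast x s)) (rev C) (semicomplete_col_converse adj) _ _ _ _ _ c.
rewrite rev_path rev_cycle rev_uniq revP mem_rev next_rev // eq_sym.
rewrite -rev_rcons -lastI has_rev; apply=> //.
exact: contra (@mergeable_converse _ _ _ _) noM.
Qed.

(** * Existence of a merge, and absorption of all cycles *)

Lemma path_cycle_mergeable D x s C :
  semicomplete_col D -> path D x s -> cycle D C -> uniq C ->
  col x != col (last x s) -> mergeable D x s C.
Proof.
move=> adj pP cC uC ne; apply: contraT => noM.
have [p2 [t [es xp2E xp2]]] := first_arc pP ne.
have p2P : p2 \in x :: s by rewrite es !inE eqxx orbT.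
have before_end b : b \in C -> D (last x s) (next C b) -> col b = col x /\ D b p2.
  move=> bC yc; have bx := col_of_arc_from_end adj pP cC uC noM bC yc.
  have /hasPn no := no_in_arcs_before_arc_from_end adj pP cC uC ne noM
    (mem_next_cycle bC) yc.
  split=> //; apply: (arc_of_col adj); first by rewrite bx (arc_col adj).
  by have := no p2 p2P; rewrite /= prev_next.
(* An arc [cx] would supply all arcs of the bypass: [x] to [next C c], [y] to [c], and [prev C c] to
   [p2]. *)
have no_to_x c : c \in C -> ~~ D c x.
  move=> cinC; apply/negP => cx; have bC : prev C c \in C by rewrite mem_prev.
  have no := no_out_arcs_after_arc_to_start adj pP cC uC ne noM cinC cx.
  have dy := col_next_of_arc_to_start adj pP cC uC noM cinC cx.
  have yc := no_out_arcs adj pP cC uC ne noM cinC dy no.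
  have xd : D x (next C c).
    apply: (arc_of_col adj); first by rewrite dy.
    by have /hasPn := no; apply; exact: mem_head.
  have [_ bp2] : col (prev C c) = col x /\ D (prev C c) p2.
    by apply: before_end; rewrite ?next_prev.
  have := no_bypass adj pP cC uC noM bC es bp2.
  by rewrite next_prev // cx => /(_ xd yc).
(* Here [prev C c] dominates [p2], so [x] cannot dominate [c]; as [prev C c] has the colour of [x],
   the vertex [c] would dominate [x], which is excluded. *)
have no_from_y c : c \in C -> ~~ D (last x s) c.
  move=> cinC; apply/negP => yc; have bC : prev C c \in C by rewrite mem_prev.
  rewrite -(next_prev uC c) in yc.
  have [bx bp2] := before_end _ bC yc.
  have nxc : ~~ D x (next C (prev C c)).
    apply/negP => xc.
    by move: (no_parallel_arcs adj pP cC uC ne noM bC xp2E xc); rewrite bp2.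
  move: (no_to_x c cinC); rewrite -{1}(next_prev uC c) => /negP; apply.
  apply: (arc_of_col adj) nxc.
  by rewrite -bx eq_sym (arc_col adj) // next_cycle.
have has_out c : c \in C -> has (D c) (x :: s).
  move=> cinC; have bC : prev C c \in C by rewrite mem_prev.
  case: (eqVneq (col c) (col (last x s))) => [cy | ncy].
    apply: contraT => no; move: (no_from_y _ bC); rewrite -(next_prev uC c) in cy no.
    by rewrite (no_out_arcs adj pP cC uC ne noM bC cy no).
  apply/hasP; exists (last x s); first exact: mem_last.
  by apply: (arc_of_col adj) ncy (no_from_y c cinC).
have step c : c \in C -> insertable D (arcs x s) c c \/
    find (D (next C c)) (x :: s) < find (D c) (x :: s) /\
    insertable D (arcs x s) c (next C c).
  move=> cinC; have := first_out_step adj pP cC uC ne noM cinC (has_out c cinC).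
  case=> [cx|ic|[_ lt [icd|[_ dx]]]]; [|by left|by right|].
    by move: (no_to_x c cinC); rewrite cx.
  by move: (no_to_x _ (mem_next_cycle cinC)); rewrite dx.
case: (pickP (mem C)) => [c0 c0C|C0]; last first.
  case: C C0 noM {cC uC before_end no_to_x no_from_y has_out step} => [_|c r /(_ c)] /=.
    by case/mergeableP; exists x, s; rewrite cats0.
  by rewrite inE eqxx.
(* The successor cannot beat the minimum, so [c] fits alone; the cycle is opened so as to end in
   [c], as the greedy split requires. *)
have [c cinC minc] := arg_minnP (fun c => find (D c) (x :: s)) c0C.
have ic : insertable D (arcs x s) c c.
  case: (step c cinC) => // -[lt _].
  by move: (minc _ (mem_next_cycle cinC)); rewrite leqNgt lt.
have [l [pe pl fl ll]] := cycle_rotate_to cC uC cinC (loopless adj c).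
have pi : pieces_insertable D (arcs x s) (next C c :: l).
  apply: pieces_insertable_greedy; last by rewrite ll.
  have aC : all (mem C) (next C c :: l) by apply/allP => u; rewrite (perm_mem pe).
  apply: sub_in_path aC fl => u v uC' _ /eqP <-.
  by case: (step u uC') => [->//|[_ ->]]; rewrite orbT.
have [t' [pt' lt' pe']] := multi_insert pP (fun _ => id) pi pl.
case/mergeableP: noM; exists x, t'; split; rewrite ?lt' //.
by apply: perm_trans pe' _; rewrite perm_cons perm_cat2l.
Qed.

Lemma path_cycles_merge D x s Cs :
  semicomplete_col D -> path D x s -> all (dicycle D) Cs ->
  col x != col (last x s) ->
  exists y t, [/\ path D y t, perm_eq (y :: t) (x :: s ++ flatten Cs)
                & col y != col (last y t)].
Proof.
move=> adj; elim: Cs x s => [|C Cs IH] x s pP.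
  by move=> _ ne; exists x, s; rewrite cats0.
case/andP=> /and3P[_ cC uC] aCs ne.
have /mergeableP[y [t [pt pe ne']]] := path_cycle_mergeable adj pP cC uC ne.
have [z [r [pr pe' ne'']]] := IH y t pt aCs ne'.
exists z, r; split=> //; apply: perm_trans pe' _.
by rewrite /= catA -!cat_cons perm_cat2r.
Qed.

End Merge.

Theorem theorem1p5 (T : finType) (D : rel T) (p : nat) (X : {set {set T}})
    (x : T) (s : seq T) (C : seq (seq T)) :
  semicomplete_partite D p X ->
  one_path_cycle_factor D x s C ->
  different_partite_sets X x (last x s) ->
  exists (y : T) (t : seq T),
    hamilton_path D y t /\ different_partite_sets X y (last y t).
Proof.
move=> scD [/andP[pP _] aC uPC covPC] /(different_partite_setsE _ _ scD) ne.
(* The colour of a vertex is its block [pblock X]. *)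
have [_ _ _ adj] := scD.
have [y [t [pt pe ne']]] := path_cycles_merge adj pP aC ne.
exists y, t; split; last exact/(different_partite_setsE _ _ scD).
split; first by rewrite /dipath pt (perm_uniq pe).
by move=> v; rewrite (perm_mem pe).
Qed.
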